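(* Let $n\ge1$ and $\vec a=(a_0,\dots,a_n)\in\mathbb{Z}^{n+1}$. If the Newton polygon of $\vec a$ has only one bounded edge, then the tropical entropy satisfies $H(\vec a)\le 1-\frac{2}{n+1}$.
   Context: A sequence $(z_1,\dots,z_k)\in\mathbb{R}^k$ satisfies $\vec a$ if for every $1\le j\le k-n$ the minimum $\min_{0\le i\le n}\{z_{j+i}+a_i\}$ is attained for at least two different values of $i$. $D(k)\subset\mathbb{R}^k$ denotes the set of all such sequences; it is a finite union of polyhedra. Put $d_{\vec a}(k):=\dim D(k)$ (the maximal dimension of a polyhedron in this union). The tropical entropy is $H(\vec a):=\lim_{k\to\infty}d_{\vec a}(k)/k$ (the limit exists by subadditivity of $d_{\vec a}$). The Newton polygon of $\vec a$ is the convex hull in $\mathbb{R}^2$ of the rays $\{(i,y): y\ge a_i\}$, $0\le i\le n$; its boundary consists of two unbounded (vertical) edges and several bounded edges. *)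

(* Defs.v *)
From HB Require Import structures.
From mathcomp Require Import all_boot all_order all_algebra.
From mathcomp Require Import all_classical all_reals all_analysis.

Set Implicit Arguments.
Unset Strict Implicit.
Unset Printing Implicit Defensive.

Import Order.TTheory GRing.Theory Num.Theory.
Import numFieldNormedType.Exports.

Local Open Scope classical_set_scope.
Local Open Scope ring_scope.

Definition polyhedron (R : realType) (k : nat) (P : set 'rV[R]_k) : Prop :=
  exists (m : nat) (A : 'M[R]_(m, k)) (b : 'cV[R]_m),
    P = [set z | forall i : 'I_m, (A *m z^T) i 0 <= b i 0].

(* Dimension of the affine hull: the largest d such that S contains d + 1
   affinely independent points x, x + row 0 M, ..., x + row (d - 1) M
   (and 0 for the empty set). *)
Definition affdim (R : realType) (k : nat) (S : set 'rV[R]_k) : nat :=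
  \max_(d < k.+1 | `[< exists (x : 'rV[R]_k) (M : 'M[R]_(d, k)),
      [/\ S x, row_free M & forall i : 'I_d, S (x + row i M)] >]) d.

Definition has_polyhedral_dim (R : realType) (k : nat) (S : set 'rV[R]_k)
    (d : nat) : Prop :=
  exists (m : nat) (P : 'I_m -> set 'rV[R]_k),
    [/\ forall i, polyhedron (P i),
        S = \bigcup_i P i
      & d = (\max_(i < m) affdim (P i))%N].

(* The value does not depend on the decomposition of S; it is only meaningful
   for finite unions of polyhedra, and 0 is a default for other sets. *)
Definition polyhedral_dim (R : realType) (k : nat) (S : set 'rV[R]_k) : nat :=
  xget 0%N [set d | has_polyhedral_dim S d].

Lemma window_subproof (n k : nat) (j : 'I_(k - n)) (i : 'I_n.+1) :
  (j + i < k)%N.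
Proof.
have := ltn_ord j; rewrite ltn_subRL addnC => jnk.
by apply: leq_ltn_trans jnk; rewrite leq_add2l -ltnS.
Qed.

Definition window (n k : nat) (j : 'I_(k - n)) (i : 'I_n.+1) : 'I_k :=
  Ordinal (window_subproof j i).

Definition min_attained_twice (R : realType) (n : nat) (f : 'I_n.+1 -> R) : bool :=
  (1 < #|[pred i | [forall l, (f i <= f l)%R]]|)%N.

(* Positions are numbered from 0, so j runs over 0 <= j < k - n; there is no
   condition when k <= n. *)
Definition satisfies (R : realType) (n : nat) (a : 'I_n.+1 -> int) (k : nat)
    (z : 'rV[R]_k) : Prop :=
  forall j : 'I_(k - n),
    min_attained_twice (fun i : 'I_n.+1 => z 0 (window j i) + (a i)%:~R).

Definition solutions (R : realType) (n : nat) (a : 'I_n.+1 -> int) (k : nat) :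
  set 'rV[R]_k := [set z | satisfies a z].
Arguments solutions R {n} a k.

Definition solution_dim (R : realType) (n : nat) (a : 'I_n.+1 -> int)
    (k : nat) : nat :=
  polyhedral_dim (solutions R a k).

(* The limit exists because solution_dim is subadditive in k. *)
Definition tropical_entropy (R : realType) (n : nat) (a : 'I_n.+1 -> int) : R :=
  limn (fun k : nat => (solution_dim R a k)%:R / k%:R : R).

Definition plane_point (R : realType) (x y : R) : 'rV[R]_2 :=
  \row_j [:: x; y]`_j.

Definition newton_polygon (R : realType) (n : nat) (a : 'I_n.+1 -> int) :
    set 'rV[R]_2 :=
  smallest (@convex_set R 'rV[R]_2)
    [set p | exists (i : 'I_n.+1) (y : R),
       (a i)%:~R <= y /\ p = plane_point (i : nat)%:R y].
Arguments newton_polygon R {n} a.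

Definition face (R : realType) (k : nat) (N F : set 'rV[R]_k) : Prop :=
  exists w : 'rV[R]_k,
    F = [set p | N p /\
         forall q, N q -> (w *m p^T) 0 0 <= (w *m q^T) 0 0].

Definition bounded_edge (R : realType) (N E : set 'rV[R]_2) : Prop :=
  [/\ face N E, affdim E = 1%N & bounded_set E].

(* Main.v *)
(* When the Newton polygon has one bounded edge, subtracting the chord from a_0
   to a_n leaves coefficients b_i >= 0 with b_0 = b_n = 0, and adding the same
   linear function to a solution z gives a sequence y satisfying b.  An entry of
   y nearest to a window and smaller than the whole window would be the unique
   minimum of the window it bounds, so every window contains a global minimum of
   y.  Order the positions by (y_p, -p) and call q dependent if, in some window,
   the minimum is attained both at q and at a smaller position.  Apart from the
   last 2n positions, each window contains two dependent positions: the larger of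
   two minimizers, and a global minimum (or the other minimizer, if the first is
   itself a global minimum).  Hence there are at least 2(k-2n)/(n+1) dependent
   positions, whose coordinates are determined by the others in the affine span
   of a polyhedron of solutions near a generic point. *)
Require Import Defs.
From HB Require Import structures.
From mathcomp Require Import all_boot all_order all_algebra.
From mathcomp Require Import all_classical all_reals all_analysis.
From mathcomp Require Import ring lra zify.

Set Implicit Arguments.
Unset Strict Implicit.
Unset Printing Implicit Defensive.

Import Order.TTheory GRing.Theory Num.Theory.
Import numFieldNormedType.Exports.

Local Open Scope classical_set_scope.
Local Open Scope ring_scope.

(** * Minimizers of a window and dependent positions *)

(** The coefficients are real because subtracting the chord from integers may leave fractions. *)
Definition minimizers (R : realType) (n : nat) (b : 'I_n.+1 -> R) (k : nat)
    (z : 'rV[R]_k) (j : 'I_(k - n)) : {set 'I_n.+1} :=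
  [set i | [forall l, z 0 (window j i) + b i <= z 0 (window j l) + b l]].

Lemma minimizersP (R : realType) (n : nat) (b : 'I_n.+1 -> R) (k : nat)
    (z : 'rV[R]_k) (j : 'I_(k - n)) (i : 'I_n.+1) :
  reflect (forall l, z 0 (window j i) + b i <= z 0 (window j l) + b l)
    (i \in minimizers b z j).
Proof. by rewrite inE; apply: forallP. Qed.

Lemma minimizers_eq (R : realType) (n : nat) (b : 'I_n.+1 -> R) (k : nat)
    (z : 'rV[R]_k) (j : 'I_(k - n)) (i1 i2 : 'I_n.+1) :
  i1 \in minimizers b z j -> i2 \in minimizers b z j ->
  z 0 (window j i1) + b i1 = z 0 (window j i2) + b i2.
Proof.
by move=> /minimizersP h1 /minimizersP h2; apply/le_anti; rewrite h1 h2.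
Qed.

(* Among equal entries the rightmost is the smallest, so that a global minimum at
   p is made dependent by the window starting at p. *)
Definition lex_lt (R : realType) (k : nat) (z : 'rV[R]_k) (p q : 'I_k) : bool :=
  (z 0 p < z 0 q) || (z 0 p == z 0 q) && (q < p)%N.

Lemma lex_lt_trans (R : realType) (k : nat) (z : 'rV[R]_k) :
  transitive (lex_lt z).
Proof.
move=> q p r /orP[h1|/andP[/eqP h1 qp]] /orP[h2|/andP[/eqP h2 rq]]; apply/orP.
- by left; apply: lt_trans h2.
- by left; rewrite -h2.
- by left; rewrite h1.
- by right; rewrite h1 h2 eqxx; apply: ltn_trans qp.
Qed.

Lemma lex_lt_irr (R : realType) (k : nat) (z : 'rV[R]_k) (p : 'I_k) :
  lex_lt z p p = false.
Proof. by rewrite /lex_lt ltxx ltnn andbF. Qed.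

Lemma lex_lt_total (R : realType) (k : nat) (z : 'rV[R]_k) (p q : 'I_k) :
  p != q -> lex_lt z p q || lex_lt z q p.
Proof.
rewrite /lex_lt -val_eqE neq_ltn /=.
by case: ltgtP => //= _; rewrite orbC.
Qed.

Definition dependent (R : realType) (n : nat) (b : 'I_n.+1 -> R) (k : nat)
    (z : 'rV[R]_k) : {set 'I_k} :=
  [set q | [exists j : 'I_(k - n), exists i1 in minimizers b z j,
     exists i2 in minimizers b z j,
       (q == window j i1) && lex_lt z (window j i2) q]].

Lemma dependentP (R : realType) (n : nat) (b : 'I_n.+1 -> R) (k : nat)
    (z : 'rV[R]_k) (q : 'I_k) :
  reflect (exists (j : 'I_(k - n)) (i1 i2 : 'I_n.+1),
    [/\ i1 \in minimizers b z j, i2 \in minimizers b z j, q = window j i1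
      & lex_lt z (window j i2) q])
    (q \in dependent b z).
Proof.
rewrite inE; apply: (iffP existsP) => [[j /exists_inP[i1 h1]]|].
  by move=> /exists_inP[i2 h2 /andP[/eqP h3 h4]]; exists j, i1, i2.
move=> [j [i1 [i2 [h1 h2 h3 h4]]]]; exists j.
apply/exists_inP; exists i1 => //; apply/exists_inP; exists i2 => //.
by rewrite h4 andbT; apply/eqP.
Qed.

Lemma window_inj (n k : nat) (j : 'I_(k - n)) : injective (@window n k j).
Proof. by move=> i1 i2 [] /addnI h; apply: val_inj. Qed.

(** * Counting dependent positions *)

Section Combinatorics.
Variables (R : realType) (n k : nat) (b : 'I_n.+1 -> R) (z : 'rV[R]_k).
Hypotheses (b_ge0 : forall i, 0 <= b i) (b0 : b ord0 = 0) (bn : b ord_max = 0).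
Hypothesis sol : forall j, (1 < #|minimizers b z j|)%N.

Lemma not_unique_min (j : 'I_(k - n)) (i0 : 'I_n.+1) :
  ~ (forall i, i != i0 ->
      z 0 (window j i0) + b i0 < z 0 (window j i) + b i).
Proof.
move=> h; have /card_gt1P[i1 [i2 [h1 h2 h12]]] := sol j.
have H i : i \in minimizers b z j -> i = i0.
  move=> /minimizersP/(_ i0) hi; apply/eqP; apply: contraT => /h.
  by rewrite ltNge hi.
by move: h12; rewrite (H _ h1) (H _ h2) eqxx.
Qed.

(* The nearest smaller entry on either side of the window would be the unique
   minimum of the window that has it as its endpoint, because b vanishes at both
   ends and is nonnegative. *)
Lemma window_global_min (j : 'I_(k - n)) :
  exists i : 'I_n.+1, forall p, z 0 (window j i) <= z 0 p.
Proof.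
have [i0 _ hi0] := @arg_minP _ _ _ (ord0 : 'I_n.+1) predT
  (fun i => z 0 (window j i)) isT.
set r := z 0 (window j i0) in hi0.
exists i0 => p; rewrite -/r leNgt; apply/negP => pr.
have inW (q : 'I_k) : (j <= q)%N -> (q <= j + n)%N -> r <= z 0 q.
  move=> jq qj; have qj' : (q - j < n.+1)%N by lia.
  have -> : q = window j (Ordinal qj') by apply: val_inj => /=; lia.
  exact: hi0.
have jk := ltn_ord j.
have [pj|jp] := ltnP p j.
- case: (@arg_maxnP _ p (fun q : 'I_k => (q < j)%N && (z 0 q < r)) val).
    by rewrite pj pr.
  move=> q /andP[qj qr] qmax.
  have qk : (q < k - n)%N by lia.
  have Eq : window (Ordinal qk) (ord0 : 'I_n.+1) = q.
    by apply: val_inj; rewrite /= addn0.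
  apply: (@not_unique_min (Ordinal qk) ord0) => i ine; rewrite Eq b0 addr0.
  apply: lt_le_trans qr _; rewrite -[r]addr0 lerD ?b_ge0//.
  have i_gt0 : (0 < i)%N by rewrite lt0n; apply: contra ine => /eqP h; apply/eqP/val_inj.
  have := ltn_ord i => ilt.
  (* Entries between [q] and [j] are at least [r] because [q] is the last smaller one; the rest lie
     in window [j], since [q < j]. *)
  have [wj|jw] := ltnP (window (Ordinal qk) i) j.
    rewrite leNgt; apply/negP => wr.
    by have := qmax (window (Ordinal qk) i); rewrite wj wr /= => /(_ isT); lia.
  by apply: inW => //=; lia.
- have jnp : (j + n < p)%N.
    by rewrite ltnNge; apply/negP => h; move: pr; rewrite ltNge inW.
  case: (@arg_minnP _ p (fun q : 'I_k => (j + n < q)%N && (z 0 q < r)) val).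
    by rewrite jnp pr.
  move=> q /andP[jq qr] qmin.
  have qk : (q - n < k - n)%N by have := ltn_ord q; lia.
  have Eq : window (Ordinal qk) (ord_max : 'I_n.+1) = q.
    by apply: val_inj => /=; lia.
  apply: (@not_unique_min (Ordinal qk) ord_max) => i ine; rewrite Eq bn addr0.
  apply: lt_le_trans qr _; rewrite -[r]addr0 lerD ?b_ge0//.
  have i_ltn : (i < n)%N.
    have := ltn_ord i; rewrite ltnS leq_eqVlt => /orP[/eqP h|//].
    by case/eqP: ine; apply: val_inj.
  have [wj|jw] := ltnP (j + n) (window (Ordinal qk) i).
    rewrite leNgt; apply/negP => wr.
    have := qmin (window (Ordinal qk) i); rewrite wj wr => /(_ isT) /=; lia.
  by apply: inW => //=; lia.
Qed.

(** In the window starting at [p], offset 0 is a minimizer. A second minimizer has an entry at most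
    [z 0 p], hence equal to it, and lies further right, so it precedes [p] in the order. *)
Lemma global_min_dependent (p : 'I_k) :
  (p < k - n)%N -> (forall q, z 0 p <= z 0 q) -> p \in dependent b z.
Proof.
move=> pk pmin; pose j := Ordinal pk.
have Ep : window j (ord0 : 'I_n.+1) = p by apply: val_inj; rewrite /= addn0.
have m0 : ord0 \in minimizers b z j.
  by apply/minimizersP => l; rewrite Ep b0 lerD.
have /card_gt1P[i1 [i2 [h1 h2 h12]]] := sol j.
have [i i0 hi] : exists2 i, i != ord0 & i \in minimizers b z j.
  have [e|ne] := eqVneq i1 ord0; last by exists i1.
  by exists i2 => //; rewrite -e eq_sym.
apply/dependentP; exists j, ord0, i; split => //.
have := minimizers_eq m0 hi; rewrite Ep b0 addr0 => E.
apply/orP; right; apply/andP; split.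
  rewrite eq_le pmin andbT E lerDl//.
by rewrite /= -[X in (X < _)%N]addn0 ltn_add2l lt0n; apply: contra i0.
Qed.

Lemma window_dependent (j : 'I_(k - n)) : (j + n < k - n)%N ->
  (1 < #|[set i | window j i \in dependent b z]%SET|)%N.
Proof.
move=> jk; have /card_gt1P[i1 [i2 [h1 h2 h12]]] := sol j.
wlog lt21 : i1 i2 h1 h2 h12 / lex_lt z (window j i2) (window j i1).
  move=> H; have ne : window j i1 != window j i2.
    by apply: contra h12 => /eqP/window_inj ->.
  case/orP: (lex_lt_total z ne).
  - by apply: H => //; rewrite eq_sym.
  - exact: H.
have L1 : window j i1 \in dependent b z by apply/dependentP; exists j, i1, i2.
(* Every position of this window is itself the start of a window, as [global_min_dependent]
   requires. *)
have lt_end (i : 'I_n.+1) : (window j i < k - n)%N.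
  by apply: leq_ltn_trans jk; rewrite /= leq_add2l -ltnS.
have [i3 m3] := window_global_min j.
apply/card_gt1P; have [e13|ne] := eqVneq i1 i3; last first.
  exists i1, i3; split => //; first by rewrite inE.
  by rewrite inE; apply: global_min_dependent.
exists i1, i2; split => //; first by rewrite inE.
rewrite inE; apply: global_min_dependent => // q.
rewrite -e13 in m3; apply: le_trans (m3 q).
by case/orP: lt21 => [/ltW//|/andP[/eqP->]].
Qed.

(** Double counting of pairs of a window and an offset that meet in a dependent position: each
    window gives at least two, and each offset at most one per dependent position. *)
Lemma card_dependent : ((k - n - n) * 2 <= n.+1 * #|dependent b z|)%N.
Proof.
pose w := widen_ord (leq_subr n (k - n)).
have -> : ((k - n - n) * 2 = \sum_(j < k - n - n) 2)%N.
  by rewrite sum_nat_const card_ord.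
apply: (@leq_trans
  (\sum_(j < k - n - n) \sum_(i < n.+1) (window (w j) i \in dependent b z))).
  apply: leq_sum => j _; rewrite -big_mkcond sum1dep_card.
  by apply: window_dependent => /=; have := ltn_ord j; lia.
rewrite exchange_big /= -[n.+1 in leqRHS]card_ord -sum_nat_const.
apply: leq_sum => i _; rewrite -big_mkcond sum1dep_card.
rewrite -(@card_imset _ _ (fun j => window (w j) i)); last first.
  by move=> j1 j2 [] /addIn h; apply: val_inj.
apply/subset_leq_card/fintype.subsetP => p /imsetP[j].
by rewrite inE => h ->.
Qed.
End Combinatorics.

(** * Generic points and the dimension of a polyhedron *)

Lemma polyhedron_convex (R : realType) (k : nat) (P : set 'rV[R]_k)
    (x y : 'rV[R]_k) (t : R) :
  polyhedron P -> P x -> P y -> 0 <= t -> t <= 1 -> P (x + t *: (y - x)).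
Proof.
move=> [m [A [c ->]]] Px Py t0 t1 i.
have := Px i; have := Py i => {}Py {}Px.
rewrite linearD linearZ linearB /= mulmxDr -scalemxAr mulmxBr !mxE.
rewrite !mxE in Px Py; nra.
Qed.

Lemma near0_ltD (R : realType) (a b c d : R) : a < b ->
  \forall e \near 0^'+, a + e * c < b + e * d.
Proof.
move=> ab; have M_gt0 : 0 < `|c - d| + 1 by rewrite ltr_wpDl.
near=> e.
have e0 : 0 < e by near: e; exact: nbhs_right_gt.
have : e < (b - a) / (`|c - d| + 1).
  by near: e; apply: nbhs_right_lt; rewrite divr_gt0 ?subr_gt0.
rewrite ltr_pdivlMr// => h; have := ler_norm (c - d) => h2; nra.
Unshelve. all: by end_near. Qed.

(* The generic point is one with as few tight pairs as possible: moving slightly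
   towards another point of P cannot create tight pairs, hence keeps all of
   them. *)
Lemma generic_point (R : realType) (n : nat) (b : 'I_n.+1 -> R) (k : nat)
    (P : set 'rV[R]_k) (x : 'rV[R]_k) :
  polyhedron P -> P x ->
  exists2 z, P z & forall y, P y -> forall j i1 i2,
    i1 \in minimizers b z j -> i2 \in minimizers b z j ->
    (y - z) 0 (window j i1) = (y - z) 0 (window j i2).
Proof.
move=> polP Px.
pose T z := [set ji : 'I_(k - n) * 'I_n.+1 | ji.2 \in minimizers b z ji.1]%SET.
case: (@arg_minnP _ (T x) (fun A => `[< exists2 z, P z & T z = A >])
  (fun A => #|A|)); first by apply/asboolP; exists x.
move=> _ /asboolP[z Pz <-] Tmin; exists z => // y Py j i1 i2 h1 h2.
(* Only finitely many strict inequalities hold at [z], so one small step [e] towards [y] preserves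
   them all. *)
have [e [e0 e1 elt]] : exists e : R, [/\ 0 < e, e <= 1 &
    forall u : 'I_(k - n) * 'I_n.+1 * 'I_n.+1,
      z 0 (window u.1.1 u.2) + b u.2 < z 0 (window u.1.1 u.1.2) + b u.1.2 ->
      z 0 (window u.1.1 u.2) + b u.2 + e * (y - z) 0 (window u.1.1 u.2) <
      z 0 (window u.1.1 u.1.2) + b u.1.2 + e * (y - z) 0 (window u.1.1 u.1.2)].
  suff : \forall e \near (0 : R)^'+, [/\ 0 < e, e <= 1 &
    forall u : 'I_(k - n) * 'I_n.+1 * 'I_n.+1,
      z 0 (window u.1.1 u.2) + b u.2 < z 0 (window u.1.1 u.1.2) + b u.1.2 ->
      z 0 (window u.1.1 u.2) + b u.2 + e * (y - z) 0 (window u.1.1 u.2) <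
      z 0 (window u.1.1 u.1.2) + b u.1.2 + e * (y - z) 0 (window u.1.1 u.1.2)].
    by move=> /filter_ex.
  near=> e; split.
  - by near: e; exact: nbhs_right_gt.
  - by near: e; apply: nbhs_right_le.
  - near: e; apply: (@filter_forall _ _ _ _ (at_right_proper_filter (0 : R))) => u.
    have [lt|ge] := ltP (z 0 (window u.1.1 u.2) + b u.2)
                        (z 0 (window u.1.1 u.1.2) + b u.1.2).
      have := near0_ltD ((y - z) 0 (window u.1.1 u.2))
        ((y - z) 0 (window u.1.1 u.1.2)) lt.
      by apply: filterS => e he _.
    by apply: nearW.
pose w := z + e *: (y - z).
have wE p i : w 0 p + b i = z 0 p + b i + e * (y - z) 0 p.
  by rewrite /w 2!mxE addrAC.
have Pw : P w by apply: polyhedron_convex => //; apply: ltW.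
have sTw : T w \subset T z.
  apply/fintype.subsetP => -[j' i]; rewrite !inE /= => /forallP wmin.
  apply/forallP => l; rewrite leNgt; apply/negP => /(elt (j', i, l)) /=.
  by rewrite -!wE ltNge wmin.
have Tw : T w = T z.
  by apply/eqP; rewrite eqEcard sTw; apply: Tmin; apply/asboolP; exists w.
have h i : i \in minimizers b z j -> i \in minimizers b w j.
  move=> hi; have : (j, i) \in T z by rewrite inE.
  by rewrite -Tw inE.
have := minimizers_eq (h _ h1) (h _ h2).
rewrite !wE (minimizers_eq h1 h2) => /addrI /mulfI; apply.
by rewrite gt_eqF.
Unshelve. all: by end_near. Qed.

(** Induction along [lex_lt]: the coordinate at a dependent position equals the one at some smaller
    position. *)
Lemma vanish_dependent (R : realType) (n : nat) (b : 'I_n.+1 -> R) (k : nat)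
    (z v : 'rV[R]_k) :
  (forall j i1 i2, i1 \in minimizers b z j -> i2 \in minimizers b z j ->
    v 0 (window j i1) = v 0 (window j i2)) ->
  (forall p, p \notin dependent b z -> v 0 p = 0) -> v = 0.
Proof.
move=> vE v0; apply/rowP => q; rewrite mxE.
have [m] := ubnP #|[set p | lex_lt z p q]%SET|; elim: m q => // m IH q qm.
have [/dependentP[j [i1 [i2 [h1 h2 qE lt]]]]|/v0 //] := boolP (q \in dependent b z).
rewrite qE (vE _ _ _ h1 h2); apply: IH; rewrite -ltnS; apply: leq_trans qm.
rewrite !ltnS; apply: proper_card; apply/properP; split.
  apply/fintype.subsetP => p; rewrite !inE => /lex_lt_trans; exact.
by exists (window j i2); rewrite !inE ?lex_lt_irr.
Qed.

(** Directions within [P] are determined by their coordinates outside the dependent set. Only the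
    minimizers matter, so [z] may be replaced by a sheared [y] with other coefficients [c]. *)
Lemma affdim_le (R : realType) (n : nat) (b : 'I_n.+1 -> R) (k : nat)
    (P : set 'rV[R]_k) (N : nat) :
  polyhedron P ->
  (forall z, P z -> exists (c : 'I_n.+1 -> R) (y : 'rV[R]_k),
    (forall j, minimizers b z j = minimizers c y j) /\
    (k - #|dependent c y| <= N)%N) ->
  (affdim P <= N)%N.
Proof.
move=> polP depP; apply/bigmax_leqP => -[d dk] /= /asboolP[x [M [Px Mfree PM]]].
have [z Pz zE] := generic_point b polP Px.
have [c [y [minE]]] := depP z Pz; apply: leq_trans.
set L := dependent c y; pose f (i : 'I_#|~: L|) := enum_val i.
have ME j i1 i2 : i1 \in minimizers c y j -> i2 \in minimizers c y j ->
    forall i, M i (window j i1) = M i (window j i2).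
  rewrite -minE => h1 h2 i; have := zE _ (PM i) _ _ _ h1 h2; have := zE _ Px _ _ _ h1 h2.
  rewrite !mxE; lra.
have : row_free (colsub f M).
  apply/inj_row_free => u; rewrite mulmx_colsub => /rowP u0.
  apply: (row_free_inj Mfree); rewrite mul0mx.
  apply: (@vanish_dependent _ n c k y) => [j i1 i2 h1 h2|p pL].
    by rewrite !mxE; apply: eq_bigr => i _; rewrite (ME _ _ _ h1 h2).
  have pL' : p \in ~: L by rewrite inE.
  by have := u0 (enum_rank_in pL' p); rewrite [LHS]mxE [RHS]mxE /f enum_rankK_in.
rewrite /row_free => /eqP <-; apply: leq_trans (rank_leq_col _) _.
by rewrite cardsCs finset.setCK card_ord.
Qed.

(** * Bounded edges of the Newton polygon *)

Lemma plane_point0 (R : realType) (x y : R) : plane_point x y 0 0 = x.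
Proof. by rewrite mxE. Qed.

Lemma plane_point1 (R : realType) (x y : R) : plane_point x y 0 1 = y.
Proof. by rewrite mxE. Qed.

Section NewtonPolygon.
Variables (R : realType) (n : nat) (a : 'I_n.+1 -> int).
Local Notation N := (newton_polygon R a).

Lemma newton_polygon_vertex (i : 'I_n.+1) :
  N (plane_point (i : nat)%:R (a i)%:~R).
Proof. by apply: sub_gen_smallest; exists i, (a i)%:~R. Qed.

(** The half-plane is convex and, as [0 <= v], contains each upward ray whose endpoint it
    contains. *)
Lemma newton_polygon_half_plane (u v c : R) : 0 <= v ->
  (forall i : 'I_n.+1, c <= u * (i : nat)%:R + v * (a i)%:~R) ->
  forall p, N p -> c <= u * p 0 0 + v * p 0 1.
Proof.
move=> v0 h; apply: smallest_sub => [x y t|p [i [y [ay ->]]]] /=.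
  rewrite !inE /= => hx hy; rewrite /conv /= !mxE.
  have t0 : 0 <= t%:num by [].
  have t1 : t%:num <= 1 by [].
  rewrite /unstable.onem; nra.
rewrite plane_point0 plane_point1; apply: le_trans (h i) _.
by rewrite lerD2l ler_wpM2l.
Qed.

Lemma newton_polygon_edge (s c : R) (i1 i2 : 'I_n.+1) : i1 != i2 ->
  (forall i : 'I_n.+1, c <= (a i)%:~R - s * (i : nat)%:R) ->
  (a i1)%:~R - s * (i1 : nat)%:R = c ->
  (a i2)%:~R - s * (i2 : nat)%:R = c ->
  bounded_edge N [set p | N p /\ p 0 1 - s * p 0 0 = c].
Proof.
move=> i12 ac ai1 ai2.
have l1 : lift ord0 ord0 = 1 :> 'I_2 by apply: val_inj.
have Nc p : N p -> c <= p 0 1 - s * p 0 0.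
  move=> /(@newton_polygon_half_plane (- s) 1 c ler01); rewrite mul1r.
  rewrite mulNr addrC; apply=> i; rewrite mul1r mulNr addrC; exact: ac.
have N0 p : N p -> 0 <= p 0 0.
  move=> /(@newton_polygon_half_plane 1 0 0 (lexx _)).
  by rewrite mul1r mul0r addr0; apply=> i; rewrite mul1r mul0r addr0.
have Nn p : N p -> p 0 0 <= n%:R.
  move=> /(@newton_polygon_half_plane (-1) 0 (- n%:R) (lexx _)).
  rewrite mulN1r mul0r addr0 lerN2; apply=> i.
  by rewrite mulN1r mul0r addr0 lerN2 ler_nat -ltnS.
have Vi (i : 'I_n.+1) : N (plane_point (i : nat)%:R (a i)%:~R) := newton_polygon_vertex i.
split.
- exists (plane_point (- s) 1).
  have wE (p : 'rV[R]_2) :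
      (plane_point (- s) 1 *m p^T) 0 0 = p 0 1 - s * p 0 0.
    rewrite mxE big_ord_recl big_ord1 l1 plane_point0.
    by rewrite plane_point1 !mxE mul1r mulNr addrC.
  apply/seteqP; split => p /= [Np].
    by move=> pc; split=> // q Nq; rewrite !wE pc; apply: Nc.
  move=> pmin; split=> //; apply/le_anti; rewrite Nc// andbT.
  by have := pmin _ (Vi i1); rewrite !wE plane_point0 plane_point1 ai1.
- apply/anti_leq/andP; split.
    apply/bigmax_leqP => -[d /= d3] /asboolP[x [M [[_ Ex] Mfree ME]]].
    rewrite leqNgt; apply/negP => d_gt1.
    have d2 : d = 2%N by lia.
    subst d.
    (* Rows of [M] are differences of points on the line, hence orthogonal to its nonzero normal;
       this is impossible for an invertible [M]. *)
    have Mv : M *m (plane_point (- s) 1)^T = 0.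
      apply/matrixP => i j; rewrite !mxE big_ord_recl big_ord1.
      rewrite l1 !mxE /=.
      by have [_] := ME i; rewrite !mxE; lra.
    have Munit : M \in unitmx by rewrite -row_free_unit.
    have := mulKmx Munit (plane_point (- s) 1)^T; rewrite Mv mulmx0.
    move=> /matrixP /(_ 1 0); rewrite !mxE /= => /eqP.
    by rewrite eq_sym oner_eq0.
  pose v := plane_point (i2 : nat)%:R (a i2)%:~R -
            plane_point (i1 : nat)%:R (a i1)%:~R : 'rV[R]_2.
  apply: (@leq_bigmax_cond _ _ _ (Ordinal (isT : 1 < 3)%N)).
  apply/asboolP; exists (plane_point (i1 : nat)%:R (a i1)%:~R), v; split.
  + by split; [exact: Vi|rewrite plane_point0 plane_point1].
  + suff v0 : v != 0 by rewrite /row_free rank_rV v0.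
    apply: contra i12 => /eqP/rowP/(_ 0); rewrite !mxE /= => /eqP.
    by rewrite subr_eq0 eqr_nat => /eqP e; apply/eqP/val_inj.
  + move=> i; have -> : row i v = v by apply/rowP => j; rewrite mxE (ord1 i).
    by rewrite addrC subrK; split; [exact: Vi|rewrite plane_point0 plane_point1].
- exists (n%:R + (`|c| + `|s| * n%:R)); split; first exact: num_real.
  move=> M hM p /= [Np pc].
  rewrite [leLHS]mx_normrE; apply/bigmax_leP; split.
    by apply: le_trans (ltW hM); rewrite !addr_ge0 ?mulr_ge0.
  move=> [i j] _ /=; rewrite ord1; apply: le_trans (ltW hM).
  have b0 := N0 _ Np; have bn := Nn _ Np.
  have : `|p 0 0| <= n%:R by rewrite ger0_norm.
  have : `|p 0 1| <= `|c| + `|s| * n%:R.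
    have -> : p 0 1 = c + s * p 0 0 by rewrite -pc subrK.
    apply: le_trans (ler_normD _ _) _; rewrite lerD2l normrM.
    by rewrite ler_wpM2l// ger0_norm.
  case: j => -[|[|//]] j2 h1 h0.
    rewrite (_ : Ordinal j2 = 0); last exact: val_inj.
    by rewrite -[leLHS]addr0 lerD// addr_ge0// mulr_ge0.
  rewrite (_ : Ordinal j2 = 1); last exact: val_inj.
  by rewrite -[leLHS]add0r lerD.
Qed.

(** A point below the chord would produce two different bounded edges, one at each end of the
    polygon. *)
Lemma newton_polygon_ge_chord : (1 <= n)%N ->
  (exists! E : set 'rV[R]_2, bounded_edge N E) ->
  forall i : 'I_n.+1,
    (a ord0)%:~R + ((a ord_max)%:~R - (a ord0)%:~R) / n%:R * (i : nat)%:R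
      <= (a i)%:~R :> R.
Proof.
move=> n1 [E [_ Euniq]] i; rewrite leNgt; apply/negP => below.
have n0 : 0 < n%:R :> R by rewrite ltr0n.
set l := _ / n%:R in below.
have lE : l * n%:R = (a ord_max)%:~R - (a ord0)%:~R by rewrite divfK// gt_eqF.
have i_gt0 : i != ord0.
  by apply/eqP => e; move: below; rewrite e mulr0 addr0 ltxx.
have i_ltn : i != ord_max.
  by apply/eqP => e; move: below; rewrite e /= lE addrC subrK ltxx.
have pos (m : 'I_n.+1) : m != ord0 -> 0 < (m : nat)%:R :> R.
  by move=> m0; rewrite ltr0n lt0n; apply: contra m0 => /eqP h; apply/eqP/val_inj.
have posn (m : 'I_n.+1) : m != ord_max -> 0 < n%:R - (m : nat)%:R :> R.
  move=> m0; rewrite subr_gt0 ltr_nat ltn_neqAle -ltnS ltn_ord andbT.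
  by apply: contra m0 => /eqP h; apply/eqP/val_inj.
(* Slopes of segments leaving the first vertex and entering the last one. The least [f] and the
   greatest [g] give supporting lines, with slopes on either side of [l]. *)
pose f m := ((a m)%:~R - (a ord0)%:~R) / (m : nat)%:R : R.
pose g m := ((a ord_max)%:~R - (a m)%:~R) / (n%:R - (m : nat)%:R) : R.
have fE m : m != ord0 -> f m * (m : nat)%:R = (a m)%:~R - (a ord0)%:~R.
  by move=> /pos m0; rewrite divfK// gt_eqF.
have gE m : m != ord_max ->
    g m * (n%:R - (m : nat)%:R) = (a ord_max)%:~R - (a m)%:~R.
  by move=> /posn m0; rewrite divfK// gt_eqF.
have [m1 m1P fmin] := @arg_minP _ _ _ i (fun m => m != ord0) f i_gt0.
have [m2 m2P gmax] := @arg_maxP _ _ _ i (fun m => m != ord_max) g i_ltn.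
have fl : f m1 < l.
  apply: le_lt_trans (fmin i i_gt0) _.
  rewrite ltr_pdivrMr ?pos//; lra.
have gl : l < g m2.
  apply: lt_le_trans (gmax i i_ltn).
  rewrite ltr_pdivlMr ?posn//; lra.
have E1 : bounded_edge N [set p | N p /\ p 0 1 - f m1 * p 0 0 = (a ord0)%:~R].
  apply: (@newton_polygon_edge _ _ ord0 m1); first by rewrite eq_sym.
  - move=> m; have [->|m0] := eqVneq m ord0; first by rewrite mulr0 subr0.
    have := fmin m m0; rewrite -(ler_pM2r (pos _ m0)) fE//; lra.
  - by rewrite mulr0 subr0.
  - by rewrite fE// opprB addrC subrK.
have E2 : bounded_edge N
    [set p | N p /\ p 0 1 - g m2 * p 0 0 = (a ord_max)%:~R - g m2 * n%:R].
  apply: (@newton_polygon_edge _ _ m2 ord_max) => //.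
  - move=> m; have [->//|m0] := eqVneq m ord_max.
    have : g m <= g m2 := gmax m m0.
    rewrite -(ler_pM2r (posn _ m0)) gE//; lra.
  - by have := gE _ m2P; lra.
have := esym (Euniq _ E1); rewrite (Euniq _ E2) => /seteqP[E12 _].
(* The first vertex lies on the first edge; lying on the second would force [g m2 = l]. *)
have {}E12 := E12 (plane_point 0 (a ord0)%:~R).
have [|_] := E12; first split.
- exact: (newton_polygon_vertex ord0).
- by rewrite plane_point0 plane_point1 mulr0 subr0.
- rewrite plane_point0 plane_point1 mulr0 subr0; nra.
Qed.
End NewtonPolygon.

(** * Bounds for the solution dimension and the entropy *)

Lemma solution_dim_le (R : realType) (n : nat) (a : 'I_n.+1 -> int) (k : nat) :
  (1 <= n)%N ->
  (forall i : 'I_n.+1,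
    (a ord0)%:~R + ((a ord_max)%:~R - (a ord0)%:~R) / n%:R * (i : nat)%:R
      <= (a i)%:~R :> R) ->
  (n.+1 * solution_dim R a k <= (n.-1) * k + 4 * n)%N.
Proof.
move=> n1 chord; rewrite /solution_dim /polyhedral_dim.
case: xgetP => [d _ [m [P [polP solE ->]]]|_]; last by rewrite muln0.
set l := _ / n%:R in chord.
have lE : l * n%:R = (a ord_max)%:~R - (a ord0)%:~R.
  by rewrite divfK// pnatr_eq0 -lt0n.
pose N := (((n.-1) * k + 4 * n) %/ n.+1)%N.
suff : (\max_(i < m) affdim (P i) <= N)%N by rewrite /N leq_divRL// mulnC.
apply/bigmax_leqP => i0 _.
apply: (@affdim_le _ n (fun i => (a i)%:~R)) => // z Pz.
have zsol : satisfies a z.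
  by have : solutions R a k z by rewrite solE; exists i0.
(* Passing to [y] and [b] changes all values in window [j] by the same constant [l * j - a ord0]. *)
pose y := z + \row_p (l * (p : nat)%:R).
pose b (i : 'I_n.+1) : R := (a i)%:~R - (a ord0)%:~R - l * (i : nat)%:R.
have minE j : minimizers (fun i => (a i)%:~R) z j = minimizers b y j.
  apply/setP => i; rewrite !inE; apply: eq_forallb => h.
  rewrite !mxE /b /= !natrD.
  by apply/idP/idP => ?; lra.
exists b, y; split=> //.
rewrite /N leq_divRL// mulnC mulnBr.
have : ((k - n - n) * 2 <= n.+1 * #|dependent b y|)%N.
  apply: card_dependent => [i||| j].
  - by rewrite /b; have := chord i; lra.
  - by rewrite /b subrr mulr0 subr0.
  - by rewrite /b /= lE subrr.
  - rewrite -minE; apply: leq_trans (zsol j) _; apply/subset_leq_card.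
    by apply/fintype.subsetP => i; rewrite !inE.
by rewrite mulSn; nia.
Qed.

Theorem theorem7p3 (R : realType) (n : nat) (n_ge1 : (1 <= n)%N)
    (a : 'I_n.+1 -> int)
    (one_edge : exists! E : set 'rV[R]_2, bounded_edge (newton_polygon R a) E) :
  tropical_entropy R a <= 1 - 2 / n.+1%:R.
Proof.
have dimP k := solution_dim_le k n_ge1 (newton_polygon_ge_chord n_ge1 one_edge).
have n1_gt0 : 0 < n.+1%:R :> R by rewrite ltr0n.
rewrite /tropical_entropy; set u := fun k : nat => _.
(* For a divergent sequence limn is the default value 0, which is within the
   bound. *)
have [cu|ncu] := pselect (cvgn u); last first.
  rewrite dvgP// subr_ge0 ler_pdivrMr// mul1r ler_nat; lia.
apply/ler_addgt0Pr => e e0; apply: limr_le => //.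
near=> k.
have k0 : 0 < k%:R :> R by rewrite ltr0n; near: k; exists 1%N.
(* From here on the error term [4 * n] is at most [k * e]. *)
have ke : 4 * n%:R / e <= k%:R by near: k; exact: nbhs_infty_ger.
rewrite /u ler_pdivrMr// -(ler_pM2l n1_gt0).
have : n.+1%:R * (solution_dim R a k)%:R <= (n.-1)%:R * k%:R + 4 * n%:R :> R.
  by rewrite -!natrM -natrD ler_nat.
have -> : (n.-1)%:R = n.+1%:R - 2 :> R by rewrite -subn1 natrB// -natr1; lra.
rewrite ler_pdivrMr// in ke.
have : n.+1%:R * (2 / n.+1%:R) = 2 :> R by rewrite mulrCA divff ?mulr1// gt_eqF.
have : k%:R * e <= n.+1%:R * (k%:R * e).
  by rewrite ler_peMl ?ler1n// mulr_ge0 ?ltW.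
set x := n.+1%:R; set w := 2 / x => xe xw.
have -> : x * ((1 - w + e) * k%:R) = x * k%:R - x * w * k%:R + x * (k%:R * e).
  by ring.
rewrite xw; lra.
Unshelve. all: by end_near. Qed.
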